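(* Let $m\ge2$, let $X=Q_{2m}=\{x_0x_1+x_2x_3+\cdots+x_{2m}x_{2m+1}=0\}\subset\mathbb{P}^{2m+1}$, and let $1\le j\le m-1$. On the affine open set $x_0\neq0$ put $z_i=x_i/x_0$ and $\Omega=dz_2dz_3\cdots dz_{2m}dz_{2m+1}$, and let $$\Omega_X^{(j)}:=\frac{\Omega}{z_1\,z_2z_3\cdots z_{2j-2}z_{2j-1}\,B_j\cdots B_{m-2}\,z_{2m}z_{2m+1}},\qquad B_k=z_1+\sum_{i=1}^kz_{2i}z_{2i+1}.$$ Then $$\iota_{V_{m+1}}\iota_{V_m}\iota_{V_1}\cdots\iota_{V_{m-1}}\Omega_X^{(j)}=d\log g_1\wedge\cdots\wedge d\log g_{m-2}\wedge d\log g_m,$$ where $g_k=\frac{x_{2k}x_{2k+1}}{x_0x_1}$ for $1\le k\le j-1$, $g_k=\frac{\sum_{i=0}^kx_{2i}x_{2i+1}}{x_0x_1}$ for $j\le k\le m-2$, and $g_m=\frac{x_{2m}x_{2m+1}}{x_0x_1}$.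
   Context: On $x_0\ne0$ the quadric is $z_1+z_2z_3+\cdots+z_{2m}z_{2m+1}=0$, with coordinates $(z_2,\dots,z_{2m+1})$. The torus $T^{m+1}$ acts by $(t_0,\dots,t_m)\cdot[x_0:\cdots:x_{2m+1}]=[t_0x_0:t_0^{-1}x_1:t_1x_2:t_1^{-1}x_3:\cdots:t_mx_{2m}:t_m^{-1}x_{2m+1}]$, and $V_1,\dots,V_{m+1}$ are the vector fields generated by this action corresponding to the weights $\psi_j=\theta_j-\theta_0$ ($1\le j\le m$), $\psi_{m+1}=-\theta_m-\theta_0$ ($\theta_k$ the weight of $t_k$), with contraction operators $$\iota_{V_i}=z_{2i}\iota_{z_{2i}}-z_{2i+1}\iota_{z_{2i+1}}\ (1\le i\le m-1),$$ $$\iota_{V_m}=z_{2m}\iota_{z_{2m}}+\sum_{i=1}^{m-1}z_{2i+1}\iota_{z_{2i+1}},\qquad \iota_{V_{m+1}}=z_{2m+1}\iota_{z_{2m+1}}+\sum_{i=1}^{m-1}z_{2i+1}\iota_{z_{2i+1}},$$ where $\iota_y$ denotes contraction (on the left) with the holomorphic vector field $\partial/\partial y$. *)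

(* Defs.v *)
From mathcomp Require Export all_boot all_order all_algebra.
From mathcomp Require Export complex.
From mathcomp Require Import zify ring.
From mathcomp Require Export boolp classical_sets reals topology normedtype derive.

Set Implicit Arguments.
Unset Strict Implicit.
Unset Printing Implicit Defensive.

Export Order.TTheory GRing.Theory Num.Theory numFieldNormedType.Exports.

#[export] Set Warnings "-notation-overridden,-ambiguous-paths".

Local Open Scope ring_scope.
Local Open Scope complex_scope.

(* The exterior algebra on dual basis vectors e_0, ..., e_(n-1) over K.  An
   element is given by its coefficients: [w S] is the coefficient of
   e_(i_1) /\ ... /\ e_(i_k), where i_1 < ... < i_k are the elements of S. *)
Definition ext (K : fieldType) (n : nat) := {ffun {set 'I_n} -> K}.

Definition ext1 (K : fieldType) (n : nat) : ext K n :=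
  [ffun S => (S == finset.set0)%:R].

Definition ext_scale (K : fieldType) (n : nat) (c : K) (a : ext K n) : ext K n :=
  [ffun S => c * a S].

(* The sign of the permutation sorting the concatenation of A and B is
   (-1) ^+ inversions A B. *)
Definition inversions (n : nat) (A B : {set 'I_n}) : nat :=
  #|[set p : 'I_n * 'I_n | [&& p.1 \in A, p.2 \in B & (p.2 < p.1)%N]]|.

Definition wedge (K : fieldType) (n : nat) (a b : ext K n) : ext K n :=
  [ffun S : {set 'I_n} =>
    \sum_(A : {set 'I_n} | A \subset S)
      (-1) ^+ inversions A (S :\: A) * a A * b (S :\: A)].

Definition ext_linear (K : fieldType) (n : nat) (c : 'rV[K]_n) : ext K n :=
  [ffun S : {set 'I_n} => \sum_(i < n) c 0 i * (S == [set i])%:R].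

(* Contraction on the left: in e_(i_1) /\ ... /\ e_(i_k) the factor e_i is
   moved to the front and then replaced by its value on v. *)
Definition contract (K : fieldType) (n : nat) (v : 'rV[K]_n) (a : ext K n) :
    ext K n :=
  [ffun S : {set 'I_n} =>
    \sum_(i < n | i \notin S)
      (-1) ^+ #|[set k in S | (k < i)%N]| * v 0 i * a (i |: S)].

(* A differential form or vector field on (an open subset of) K^n is a function
   of the point, with the usual coordinates as frame. *)
Definition form (K : fieldType) (n : nat) := 'rV[K]_n -> ext K n.
Definition vfield (K : fieldType) (n : nat) := 'rV[K]_n -> 'rV[K]_n.

Definition form_wedge (K : fieldType) (n : nat) (a b : form K n) : form K n :=
  fun z => wedge (a z) (b z).

Definition wedge_seq (K : fieldType) (n : nat) (s : seq (form K n)) : form K n :=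
  foldr (@form_wedge K n) (fun=> ext1 K n) s.

Definition interior_product (K : fieldType) (n : nat) (V : vfield K n)
    (w : form K n) : form K n :=
  fun z => contract (V z) (w z).

(* The differential df = \sum_i (df/dz_i) dz_i. *)
Definition dform (K : numFieldType) (n : nat) (f : 'rV[K]_n -> K) : form K n :=
  fun z => ext_linear (\row_(i < n) 'D_(delta_mx 0 i) f z).

Definition dlog (K : numFieldType) (n : nat) (f : 'rV[K]_n -> K) : form K n :=
  fun z => ext_scale (f z)^-1 (dform f z).

(* Homogeneous coordinates x_0, ..., x_(2m+1), indexed by nat; the value 0 for
   k > 2m+1 is never used. *)
Definition hc (K : fieldType) (m : nat) (x : 'rV[K]_((2 * m).+2)) (k : nat) : K :=
  if insub k is Some i then x 0 i else 0.

Definition on_quadric (K : fieldType) (m : nat) (x : 'rV[K]_((2 * m).+2)) : Prop :=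
  \sum_(0 <= i < m.+1) hc x (2 * i) * hc x (2 * i).+1 = 0.

(* The coordinates (z_2, ..., z_(2m+1)) of the point [x_0 : ... : x_(2m+1)] of
   the quadric with x_0 <> 0; the entry of index i is z_(i+2). *)
Definition chart (K : fieldType) (m : nat) (x : 'rV[K]_((2 * m).+2)) :
    'rV[K]_(2 * m) :=
  \row_(i < 2 * m) (hc x i.+2 / hc x 0).

Definition unchart (K : fieldType) (m : nat) (z : 'rV[K]_(2 * m)) :
    'rV[K]_((2 * m).+2) :=
  let y k := if insub k is Some i then z 0 i else 0 in
  \row_(i < (2 * m).+2)
    match val i with
    | 0 => 1
    | 1 => - \sum_(1 <= l < m.+1) y (2 * l - 2)%N * y (2 * l - 1)%N
    | k.+2 => y k
    end.

(* The function z_k = x_k / x_0 on the chart, for 0 <= k <= 2m+1; in particular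
   z_1 = - (z_2 z_3 + ... + z_(2m) z_(2m+1)). *)
Definition zc (K : fieldType) (m k : nat) (z : 'rV[K]_(2 * m)) : K :=
  hc (unchart z) k / hc (unchart z) 0.

Lemma hcE (K : fieldType) (m k : nat) (x : 'rV[K]_((2 * m).+2))
    (lt_k : (k < (2 * m).+2)%N) :
  hc x k = x 0 (Ordinal lt_k).
Proof. by rewrite /hc insubT. Qed.

Lemma unchart0 (K : fieldType) (m : nat) (z : 'rV[K]_(2 * m)) :
  hc (unchart z) 0 = 1.
Proof. by rewrite (@hcE _ _ 0) // mxE. Qed.

Lemma unchart1 (K : fieldType) (m : nat) (z : 'rV[K]_(2 * m)) :
  hc (unchart z) 1 =
  - \sum_(1 <= l < m.+1) hc (unchart z) (2 * l) * hc (unchart z) (2 * l).+1.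
Proof.
rewrite (@hcE _ _ 1) // mxE /=; congr (- _).
apply: eq_big_nat => -[//|l] /andP[_ lt_lm].
have lt1 : ((2 * l).+3 < (2 * m).+2)%N by lia.
have -> : (2 * l.+1 - 2 = 2 * l)%N by lia.
have -> : (2 * l.+1 - 1 = (2 * l).+1)%N by lia.
have -> : (2 * l.+1 = (2 * l).+2)%N by lia.
by rewrite (hcE _ (ltnW lt1)) (hcE _ lt1) !mxE.
Qed.

Lemma unchart_on_quadric (K : fieldType) (m : nat) (z : 'rV[K]_(2 * m)) :
  on_quadric (unchart z).
Proof.
by rewrite /on_quadric big_ltn // muln0 unchart0 mul1r unchart1 addNr.
Qed.

Lemma unchartK (K : fieldType) (m : nat) : cancel (@unchart K m) (@chart K m).
Proof.
move=> z; apply/rowP=> i; rewrite mxE unchart0 divr1.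
have lt_i : (i.+2 < (2 * m).+2)%N by rewrite !ltnS.
by rewrite (hcE _ lt_i) mxE /= valK.
Qed.

Lemma chartK (K : fieldType) (m : nat) (x : 'rV[K]_((2 * m).+2)) :
  on_quadric x -> hc x 0 != 0 -> unchart (chart x) = (hc x 0)^-1 *: x.
Proof.
move=> Qx x0_neq0.
have hcZ k : hc ((hc x 0)^-1 *: x) k = hc x k / hc x 0.
  by rewrite /hc; case: insubP => [i _ _|_]; rewrite ?mxE ?mul0r // mulrC.
have hcC k : (k < 2 * m)%N -> hc (unchart (chart x)) k.+2 = hc x k.+2 / hc x 0.
  move=> lt_k; have lt_k2 : (k.+2 < (2 * m).+2)%N by rewrite !ltnS.
  by rewrite (hcE _ lt_k2) mxE /= insubT mxE.
suff hcQ k : (k < (2 * m).+2)%N ->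
    hc (unchart (chart x)) k = hc ((hc x 0)^-1 *: x) k.
  by apply/rowP=> i; have := hcQ i (ltn_ord i); rewrite /hc valK.
rewrite hcZ; case: k => [_|[_|k lt_k]]; last exact: hcC.
  by rewrite unchart0 divff.
rewrite unchart1; apply: (mulIf x0_neq0); rewrite divfK //.
apply: (mulfI x0_neq0); move/eqP: Qx.
rewrite big_ltn // muln0 addr_eq0 => /eqP->.
rewrite mulNr mulrN; congr (- _); rewrite mulr_suml mulr_sumr.
apply: eq_big_nat => -[//|l] /andP[_ lt_lm].
have -> : (2 * l.+1 = (2 * l).+2)%N by lia.
by rewrite !hcC; [field | lia | lia].
Qed.

(* The coordinate vector field d/dz_k, for 2 <= k <= 2m+1. *)
Definition ddz (K : fieldType) (m k : nat) : 'rV[K]_(2 * m) :=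
  \row_(i < 2 * m) (i.+2 == k)%:R.

(* V_1, ..., V_(m+1); the last case is i = m+1. *)
Definition torus_field (K : fieldType) (m i : nat) : vfield K (2 * m) := fun z =>
  if (i < m)%N then
    zc (2 * i) z *: ddz K m (2 * i) - zc (2 * i).+1 z *: ddz K m (2 * i).+1
  else
    let k := if i == m then (2 * m)%N else (2 * m).+1 in
    zc k z *: ddz K m k
      + \sum_(1 <= l < m) zc (2 * l).+1 z *: ddz K m (2 * l).+1.

Definition Omega (K : numFieldType) (m : nat) : form K (2 * m) :=
  wedge_seq [seq dform (@zc K m k) | k <- iota 2 (2 * m)].

Definition Bsum (K : fieldType) (m k : nat) (z : 'rV[K]_(2 * m)) : K :=
  zc 1 z + \sum_(1 <= i < k.+1) zc (2 * i) z * zc (2 * i).+1 z.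

Definition Omega_den (K : fieldType) (m j : nat) (z : 'rV[K]_(2 * m)) : K :=
  zc 1 z * (\prod_(2 <= k < 2 * j) zc k z) * (\prod_(j <= k < m.-1) Bsum k z)
    * zc (2 * m) z * zc (2 * m).+1 z.

Definition Omega_X (K : numFieldType) (m j : nat) : form K (2 * m) :=
  fun z => ext_scale (Omega_den j z)^-1 (@Omega K m z).

(* The rational function g_k on the quadric, in homogeneous coordinates; the
   relevant indices are 1 <= k <= m-2 and k = m. *)
Definition gfun (K : fieldType) (m j k : nat) (x : 'rV[K]_((2 * m).+2)) : K :=
  if (j <= k <= m - 2)%N then
    (\sum_(0 <= i < k.+1) hc x (2 * i) * hc x (2 * i).+1) / (hc x 0 * hc x 1)
  else hc x (2 * k) * hc x (2 * k).+1 / (hc x 0 * hc x 1).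

(* Main.v *)
Require Import Defs.
From HB Require Import structures.
From mathcomp Require Import zify ring.

(* Write q_i = z_(2i) z_(2i+1).  Contracting dz_2 ... dz_(2m+1) with V_(m-1), ...,
   V_1 turns each pair dz_(2i) dz_(2i+1), i < m, into dq_i, and wedging with
   dz_(2m+1) turns dz_(2m) into dq_m / z_(2m+1).  Since
   z_1 = - (q_1 + ... + q_m) and B_k = - (q_(k+1) + ... + q_m), a unitriangular
   change of coframe (up to signs) rewrites dq_1 ... dq_m as
   (-1)^m dz_1 E_1 ... E_(m-1), where E_k is dq_k for k < j and dB_k for k >= j,
   with B_(m-1) = - q_m.  Behind dz_1 each E_k may be replaced by a multiple of
   dlog g_k.  Both V_m and V_(m+1) scale every q_i with weight one, hence kill
   the homogeneous dlog g_k; they only see dlog z_1 and dlog z_(2m+1), and the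
   two signs cancel. *)

Set Implicit Arguments.
Unset Strict Implicit.
Unset Printing Implicit Defensive.

Local Open Scope ring_scope.
Local Open Scope complex_scope.

(** * Wedging with a linear form, contraction, and their commutation rules *)

Section ExteriorAlgebra.
Variables (K : numFieldType) (n : nat).
Local Notation E := {ffun {set 'I_n} -> K^o}.
Implicit Types (c d v : 'rV[K]_n) (w : E) (S : {set 'I_n}) (s t : seq 'rV[K]_n).

(* The codomain K^o makes forms an lmodType, so that these operators are linear
   maps. *)
Definition lwedge c (w : E) : E := wedge (ext_linear c) w.
Definition lcontract v (w : E) : E := contract v w.
Definition nbelow S (i : 'I_n) : nat := #|[set k in S | (k < i)%N]|.

Lemma inversions1 (i : 'I_n) S : inversions [set i] (S :\ i) = nbelow S i.
Proof.
rewrite /inversions /nbelow.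
rewrite -[RHS](card_imset _ (fun k k' (e : (i, k) = (i, k')) => congr1 snd e)).
apply: eq_card => -[a b]; rewrite !inE /=.
apply/idP/imsetP => [/and3P[/eqP-> /andP[_ bS] lt]|[k]].
  by exists b; rewrite ?inE ?bS.
rewrite inE => /andP[kS lt] [-> ->]; rewrite eqxx kS lt !andbT /=.
by apply: contraTneq lt => ->; rewrite ltnn.
Qed.

(** A linear form has no coefficients outside the singletons, so the sum over subsets collapses to
    one over elements of [S]. *)
Lemma lwedgeE c w S :
  lwedge c w S = \sum_(i in S) (-1) ^+ nbelow S i * c 0 i * w (S :\ i).
Proof.
rewrite ffunE.
transitivity (\sum_(A : {set 'I_n} | A \subset S) \sum_(i < n)
   (A == [set i])%:R * ((-1) ^+ inversions A (S :\: A) * c 0 i * w (S :\: A))).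
  apply: eq_bigr => A _; rewrite ffunE mulr_sumr mulr_suml.
  by apply: eq_bigr => i _; rewrite mulrA; ring.
rewrite exchange_big /= [RHS]big_mkcond; apply: eq_bigr => i _.
case: ifP => iS.
  rewrite (bigD1 [set i]) ?finset.sub1set ?iS // eqxx inversions1 big1 /= ?mul1r ?addr0 //.
  by move=> A /andP[_ /negPf->]; rewrite mul0r.
rewrite big1 // => A AS; case: eqP AS => [->|]; last by rewrite mul0r.
by rewrite finset.sub1set iS.
Qed.

Lemma lcontractE v w S :
  lcontract v w S = \sum_(i < n | i \notin S) (-1) ^+ nbelow S i * v 0 i * w (i |: S).
Proof. by rewrite ffunE. Qed.

Lemma lwedge_is_linear c : linear (lwedge c).
Proof.
move=> a u w; apply/ffunP => S; rewrite !ffunE -/(lwedge c _ _).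
rewrite scaler_sumr -big_split /=; apply: eq_bigr => A _.
by rewrite !ffunE /GRing.scale /=; ring.
Qed.
HB.instance Definition _ c :=
  GRing.isLinear.Build K E E _ (lwedge c) (lwedge_is_linear c).

Lemma lcontract_is_linear v : linear (lcontract v).
Proof.
move=> a u w; apply/ffunP => S; rewrite !ffunE.
rewrite scaler_sumr -big_split /=; apply: eq_bigr => A _.
by rewrite !ffunE /GRing.scale /=; ring.
Qed.
HB.instance Definition _ v :=
  GRing.isLinear.Build K E E _ (lcontract v) (lcontract_is_linear v).

Lemma lwedgeDl c d w : lwedge (c + d) w = lwedge c w + lwedge d w.
Proof.
apply/ffunP => S; rewrite [RHS]ffunE !lwedgeE -big_split /=.
by apply: eq_bigr => i _; rewrite mxE; ring.
Qed.

Lemma lwedgeZl a c w : lwedge (a *: c) w = a *: lwedge c w.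
Proof.
apply/ffunP => S; rewrite [RHS]ffunE !lwedgeE scaler_sumr /=.
by apply: eq_bigr => i _; rewrite mxE /GRing.scale /=; ring.
Qed.

Lemma lwedgeNl c w : lwedge (- c) w = - lwedge c w.
Proof. by rewrite -scaleN1r lwedgeZl scaleN1r. Qed.

Lemma lwedge_suml (I : Type) (r : seq I) (P : pred I) (F : I -> 'rV[K]_n) w :
  lwedge (\sum_(i <- r | P i) F i) w = \sum_(i <- r | P i) lwedge (F i) w.
Proof.
have lwedge0 : lwedge 0 w = 0 by rewrite -(scale0r 0) lwedgeZl scale0r.
by apply: (big_morph (fun c => lwedge c w) _ lwedge0) => c d; rewrite lwedgeDl.
Qed.

Lemma nbelowD1 S (i k : 'I_n) : i \in S -> nbelow S k = (nbelow (S :\ i) k + (i < k))%N.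
Proof.
move=> iS; rewrite /nbelow; case: ltnP => ik.
  rewrite (cardsD1 i) !inE iS ik /= addnC; congr (_ + _)%N; apply: eq_card => l.
  by rewrite !inE andbA.
rewrite addn0; apply: eq_card => l; rewrite !inE.
by case: eqP => // ->; rewrite ltnNge ik andbF.
Qed.

Lemma nbelowU1 S (i k : 'I_n) : i \notin S -> nbelow (i |: S) k = (nbelow S k + (i < k))%N.
Proof. by move=> iS; rewrite (@nbelowD1 _ i) ?setU11 // setU1K. Qed.

Lemma sign_swap (i k : 'I_n) : i != k -> 
  (-1) ^+ (i < k)%N = - (-1) ^+ (k < i)%N :> K.
Proof.
rewrite -val_eqE /=; case: ltngtP => //= _ _; rewrite ?expr0 ?expr1 ?opprK //.
Qed.

(** Both sides expand to double sums over ordered pairs of distinct elements of [S]. After the two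
    indices are matched, the sign exponents differ by [(i < k)] against [(k < i)], exactly one of
    which is 1. *)
Lemma lwedgeC c d w : lwedge c (lwedge d w) = - lwedge d (lwedge c w).
Proof.
apply/ffunP => S; rewrite [RHS]ffunE !lwedgeE -sumrN.
have expand (e f : 'rV[K]_n) :
    \sum_(i in S) (-1) ^+ nbelow S i * e 0 i * lwedge f w (S :\ i) =
    \sum_(i in S) \sum_(k in S | i != k) (-1) ^+ nbelow S i * (-1) ^+ nbelow (S :\ i) k
        * (e 0 i * f 0 k) * w (S :\ i :\ k).
  apply: eq_bigr => i iS; rewrite lwedgeE mulr_sumr.
  apply: eq_big => [k|k _]; last by ring.
  by rewrite !inE eq_sym andbC.
rewrite sumrN !expand (exchange_big_dep (mem S)) /=; last by move=> i k _ /andP[].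
rewrite -sumrN; apply: eq_bigr => i iS; rewrite -sumrN.
apply: eq_big => [k|k /andP[kS /andP[_ ik]]]; first by rewrite iS eq_sym.
rewrite eq_sym in ik.
have -> : S :\ k :\ i = S :\ i :\ k by apply/setP => l; rewrite !inE andbCA.
rewrite (nbelowD1 k iS) (nbelowD1 i kS) !exprD (sign_swap ik); ring.
Qed.

(** By anticommutation the form is its own negative, and [K] has characteristic 0. *)
Lemma lwedgexx c w : lwedge c (lwedge c w) = 0.
Proof.
apply/eqP; have /eqP := lwedgeC c c w.
by rewrite -subr_eq0 opprK -mulr2n -scaler_nat scaler_eq0 pnatr_eq0.
Qed.

Definition pair v c : K := \sum_(i < n) v 0 i * c 0 i.

(** Contraction is an antiderivation. At the coefficient of [S], contracting the wedge yields the
    diagonal terms with [i] outside [S], wedging the contraction yields those with [i] in [S], and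
    together they make up the pairing. The off-diagonal double sums cancel. *)
Lemma lcontract_lwedge v c w :
  lcontract v (lwedge c w) = pair v c *: w - lwedge c (lcontract v w).
Proof.
have coef a (u t : E) S : (a *: u - t) S = a * u S - t S by rewrite !ffunE.
apply/ffunP => S; rewrite coef lcontractE lwedgeE.
have -> : \sum_(i < n | i \notin S) (-1) ^+ nbelow S i * v 0 i
      * lwedge c w (i |: S)
    = \sum_(i < n | i \notin S) v 0 i * c 0 i * w S
    + \sum_(i < n | i \notin S) \sum_(k in S)
      (-1) ^+ nbelow S i * (-1) ^+ nbelow (i |: S) k * (v 0 i * c 0 k) * w ((i |: S) :\ k).
  rewrite -big_split; apply: eq_bigr => i iS; rewrite lwedgeE.
  rewrite big_setU1 //= mulrDr; congr (_ + _).
    rewrite setU1K // nbelowU1 // ltnn addn0.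
    by rewrite -[RHS](signrMK (nbelow S i)); ring.
  by rewrite mulr_sumr; apply: eq_bigr => k _; ring.
have -> : \sum_(i in S) (-1) ^+ nbelow S i * c 0 i * lcontract v w (S :\ i)
    = \sum_(i in S) v 0 i * c 0 i * w S
    + \sum_(k in S) \sum_(i < n | i \notin S)
      (-1) ^+ nbelow S k * (-1) ^+ nbelow (S :\ k) i * (v 0 i * c 0 k) * w (i |: (S :\ k)).
  rewrite -big_split; apply: eq_bigr => i iS; rewrite lcontractE.
  (* The index [i] itself lies outside [S :\ i] and gives the diagonal term; the other indices are
     those outside [S]. *)
  rewrite (bigD1 i) ?inE ?eqxx //= mulrDr; congr (_ + _).
    rewrite finset.setD1K // (@nbelowD1 _ i) // ltnn addn0.
    by rewrite -[RHS](signrMK (nbelow (S :\ i) i)); ring.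
  rewrite mulr_sumr; apply: eq_big => [k|k _]; last by ring.
  by rewrite !inE negb_and negbK; case: (k =P i) => [->|] /=; rewrite ?iS ?andbT ?andbF.
have -> : pair v c * w S = \sum_(i in S) v 0 i * c 0 i * w S
    + \sum_(i < n | i \notin S) v 0 i * c 0 i * w S.
  by rewrite /pair (bigID (mem S)) mulrDl !mulr_suml.
rewrite opprD addrACA subrr add0r; congr (_ + _).
rewrite exchange_big -sumrN; apply: eq_bigr => k kS; rewrite -sumrN.
apply: eq_bigr => i iS.
have ik : i != k by apply: contraNneq iS => ->.
have -> : (i |: S) :\ k = i |: (S :\ k).
  by apply/setP => l; rewrite !inE andb_orr; case: (l =P i) => [->|_]; rewrite ?ik ?andbF.
rewrite nbelowU1 // (nbelowD1 i kS) !exprD (sign_swap ik).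
by rewrite -[RHS](signrMK (k < i)%N); ring.
Qed.
End ExteriorAlgebra.

(** * Iterated wedge products *)

Section IteratedWedge.
Variables (K : numFieldType) (n : nat).
Local Notation E := {ffun {set 'I_n} -> K^o}.
Implicit Types (c v : 'rV[K]_n) (w : E) (s t : seq 'rV[K]_n).

(** The tail [w] is arbitrary, so that a product can be cut anywhere and its last factors treated
    separately. *)
Definition lwedges s w : E := foldr (@lwedge K n) w s.

Lemma lwedges_cat s t w : lwedges (s ++ t) w = lwedges s (lwedges t w).
Proof. exact: foldr_cat. Qed.

Lemma lwedgesZ s a w : lwedges s (a *: w) = a *: lwedges s w.
Proof. by elim: s => //= c s ->; rewrite linearZ. Qed.

Lemma lwedges0 s : lwedges s 0 = 0.
Proof. by elim: s => //= c s ->; rewrite linear0. Qed.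

Lemma lwedge_lwedges c s w :
  lwedge c (lwedges s w) = (-1) ^+ size s *: lwedges s (lwedge c w).
Proof.
elim: s => [|d s IHs] /=; first by rewrite scale1r.
by rewrite lwedgeC IHs linearZ exprS mulN1r scaleNr.
Qed.

Lemma lwedge_lwedges_mem c s w : c \in s -> lwedge c (lwedges s w) = 0.
Proof.
elim: s => //= d s IHs; rewrite inE => /predU1P[->|/IHs sc0].
  exact: lwedgexx.
by rewrite lwedgeC sc0 linear0 oppr0.
Qed.

Lemma pairC v c : pair v c = pair c v.
Proof. by apply: eq_bigr => i _; rewrite mulrC. Qed.

Lemma pairDr v c d : pair v (c + d) = pair v c + pair v d.
Proof. by rewrite -big_split; apply: eq_bigr => i _; rewrite mxE mulrDr. Qed.

Lemma pairZr v a c : pair v (a *: c) = a * pair v c.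
Proof. by rewrite mulr_sumr; apply: eq_bigr => i _; rewrite mxE mulrCA. Qed.

Lemma pairNr v c : pair v (- c) = - pair v c.
Proof. by rewrite -scaleN1r pairZr mulN1r. Qed.

Lemma pair0r v : pair v 0 = 0.
Proof. by rewrite -(scale0r 0) pairZr mul0r. Qed.

Lemma pair_sumr (I : Type) (r : seq I) (P : pred I) (F : I -> 'rV[K]_n) v :
  pair v (\sum_(i <- r | P i) F i) = \sum_(i <- r | P i) pair v (F i).
Proof. exact: (big_morph _ (pairDr v) (pair0r v)). Qed.

Lemma lcontract_lwedges v s w : (forall c, c \in s -> pair v c = 0) ->
  lcontract v (lwedges s w) = (-1) ^+ size s *: lwedges s (lcontract v w).
Proof.
elim: s => [|c s IHs] sv /=; first by rewrite scale1r.
rewrite lcontract_lwedge sv ?mem_head // scale0r sub0r.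
rewrite IHs => [|d sd]; last by rewrite sv // inE sd orbT.
by rewrite linearZ exprS mulN1r scaleNr.
Qed.

Lemma lcontract_ext1 v : lcontract v (ext1 K n) = 0.
Proof.
apply/ffunP => S; rewrite !ffunE big1 // => i _; rewrite ffunE.
case: eqP => [/setP/(_ i)|]; last by rewrite mulr0.
by rewrite setU11 inE.
Qed.

(** Behind the factor [c], the other factors matter only modulo [c]. *)
Lemma lwedge_mod (T : Type) (r : seq T) (a b : T -> K) (f : T -> 'rV[K]_n) c w :
  lwedge c (lwedges [seq a k *: f k + b k *: c | k <- r] w) =
  (\prod_(k <- r) a k) *: lwedge c (lwedges [seq f k | k <- r] w).
Proof.
elim: r => [|k r IHr] /=; first by rewrite big_nil scale1r.
rewrite lwedgeDl !lwedgeZl linearD !linearZ /= lwedgexx scaler0 addr0.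
by rewrite lwedgeC IHr linearZ /= [in RHS]lwedgeC big_cons !scalerN scalerA.
Qed.

(** The change of basis is triangular with diagonal -1: by induction the later factors already
    contain every summand of the first one except its leading term [d j.+1]. *)
Lemma lwedges_suffix_sums (d : nat -> 'rV[K]_n) j N w :
  lwedges [seq - \sum_(k.+1 <= i < (j + N).+1) d i | k <- iota j N] w =
  (-1) ^+ N *: lwedges [seq d i | i <- iota j.+1 N] w.
Proof.
elim: N j => [|N IHN] j; first by rewrite scale1r.
rewrite /= addnS -addSn IHN linearZ /= lwedgeNl.
rewrite big_ltn ?ltnS ?leq_addr // lwedgeDl lwedge_suml.
rewrite big_nat big1 ?addr0 => [|i /andP[lt_i i_lt]].
  by rewrite scalerN exprS mulN1r scaleNr.
apply: lwedge_lwedges_mem; apply: map_f; rewrite mem_iota; lia.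
Qed.

(** * The change of coframe, and contraction with two fields of weight one *)

Section AffineCoordinates.
Variables (m j : nat) (d : nat -> 'rV[K]_n) (q : nat -> K).
Hypothesis hj : (0 < j < m)%N.

(* With f i = z_(2i) z_(2i+1), [tail_sum f k] is B_k by the equation of the
   quadric; in particular [tail_sum f 0] is z_1 and [mixed_tail f m.-1] is
   - z_(2m) z_(2m+1), the numerator of g_m up to sign. *)
Definition tail_sum (V : zmodType) (f : nat -> V) k : V :=
  - \sum_(k.+1 <= i < m.+1) f i.
Definition mixed_tail (V : zmodType) (f : nat -> V) k : V :=
  if (k < j)%N then f k else tail_sum f k.
Definition dlog_ratio k : 'rV[K]_n :=
  (mixed_tail q k)^-1 *: mixed_tail d k - (tail_sum q 0)^-1 *: tail_sum d 0.

Lemma lwedges_tail_sums w :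
  lwedges [seq d i | i <- iota 1 m] w =
  (-1) ^+ m *: lwedge (tail_sum d 0)
    (lwedges [seq mixed_tail d k | k <- iota 1 m.-1] w).
Proof.
have -> : iota 1 m.-1 = iota 1 j.-1 ++ iota j (m - j).
  have -> : m.-1 = (j.-1 + (m - j))%N by lia.
  by rewrite iotaD add1n prednK //; lia.
have -> : iota 1 m = iota 1 j.-1 ++ j :: iota j.+1 (m - j).
  have {1}-> : m = (j.-1 + (m - j).+1)%N by lia.
  by rewrite iotaD add1n prednK //; lia.
rewrite !map_cat !lwedges_cat /=.
have -> : [seq mixed_tail d k | k <- iota 1 j.-1] = [seq d k | k <- iota 1 j.-1].
  apply/eq_in_map => k; rewrite mem_iota => hk.
  by rewrite /mixed_tail ifT //; lia.
have -> : [seq mixed_tail d k | k <- iota j (m - j)] =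
    [seq - \sum_(k.+1 <= i < (j + (m - j)).+1) d i | k <- iota j (m - j)].
  apply/eq_in_map => k; rewrite mem_iota => hk.
  rewrite /mixed_tail ifF; last by lia.
  by rewrite subnKC //; lia.
rewrite lwedges_suffix_sums lwedgesZ linearZ /= -lwedges_cat -map_cat.
(* Of all summands of [tail_sum d 0] only [d j] survives: those with index below or above [j] repeat
   a factor already present. *)
rewrite /tail_sum lwedgeNl lwedge_suml (big_cat_nat _ (n := j)) //=; try lia.
rewrite big_nat big1 ?add0r => [|i hi]; last first.
  apply: lwedge_lwedges_mem; apply: map_f; rewrite mem_cat !mem_iota; lia.
rewrite big_ltn; last by lia.
rewrite big_nat big1 ?addr0 => [|i hi]; last first.
  apply: lwedge_lwedges_mem; apply: map_f; rewrite mem_cat !mem_iota; lia.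
rewrite map_cat lwedges_cat; move: (lwedges [seq d i | i <- iota j.+1 _] w) => y.
rewrite lwedge_lwedges !scalerN !scalerA size_map size_iota -scaleNr.
rewrite -!exprD -[LHS]scale1r; congr (_ *: _).
(* The exponent adds up [m], the [m - j] of the suffix sums, and the [j - 1] factors passed by
   [d j]. Being odd, it cancels the minus sign of [tail_sum]. *)
rewrite (_ : (_ + _)%N = m.-1.*2.+1); last by lia.
by rewrite exprS mulN1r opprK -signr_odd odd_double.
Qed.

Lemma pair_mixed_tail v k : (forall i, (0 < i <= m)%N -> pair v (d i) = q i) ->
  (0 < k <= m)%N -> pair v (mixed_tail d k) = mixed_tail q k.
Proof.
move=> vd hk; rewrite /mixed_tail; case: ifP => _; first exact: vd.
rewrite /tail_sum pairNr pair_sumr; congr (- _).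
by apply: eq_big_nat => i hi; apply: vd; lia.
Qed.

Lemma pair_tail_sum v k : (forall i, (0 < i <= m)%N -> pair v (d i) = q i) ->
  pair v (tail_sum d k) = tail_sum q k.
Proof.
move=> vd; rewrite /tail_sum pairNr pair_sumr; congr (- _).
by apply: eq_big_nat => i hi; apply: vd; lia.
Qed.

(** Here [al], [be] stand for dz_(2m), dz_(2m+1), the scalars [a], [b] for z_(2m), z_(2m+1), and
    [v1], [v2] for V_m, V_(m+1). The first contraction is absorbed by [tail_sum d 0], the second by
    [be]. *)
Lemma lcontract2_lwedges (al be v1 v2 : 'rV[K]_n) (a b : K) :
  d m = a *: be + b *: al -> b != 0 ->
  (forall i, (0 < i <= m)%N -> pair v1 (d i) = q i) ->
  (forall i, (0 < i <= m)%N -> pair v2 (d i) = q i) ->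
  pair v1 be = 0 -> pair v2 be = b -> tail_sum q 0 != 0 ->
  (forall k, (0 < k < m)%N -> mixed_tail q k != 0) ->
  lcontract v2 (lcontract v1
    (lwedges [seq d i | i <- iota 1 m.-1] (lwedge al (lwedge be (ext1 K n))))) =
  - (tail_sum q 0 * \prod_(k <- iota 1 m.-1) mixed_tail q k) *:
  lwedges [seq dlog_ratio k | k <- iota 1 m.-1] (ext1 K n).
Proof.
move=> dm b0 v1d v2d v1b v2b z0 e0.
set w1 := lwedge be (ext1 K n).
set z := tail_sum q 0; set p := \prod_(k <- _) _.
have -> : lwedges [seq d i | i <- iota 1 m.-1] (lwedge al w1) =
    b^-1 *: lwedges [seq d i | i <- iota 1 m] w1.
  have -> : iota 1 m = iota 1 m.-1 ++ [:: m].
    have {1}-> : m = (m.-1 + 1)%N by lia.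
    by rewrite iotaD add1n prednK //; lia.
  rewrite map_cat lwedges_cat /= dm lwedgeDl !lwedgeZl lwedgexx scaler0 add0r.
  by rewrite lwedgesZ scalerA mulVf // scale1r.
(* Numerator and denominator of each ratio have the same weight, so a field of weight one
   annihilates its logarithmic differential. *)
have pair_dlog v : (forall i, (0 < i <= m)%N -> pair v (d i) = q i) ->
    forall c, c \in [seq dlog_ratio k | k <- iota 1 m.-1] -> pair v c = 0.
  move=> vd c /mapP[k]; rewrite mem_iota => hk ->.
  rewrite /dlog_ratio pairDr pairNr !pairZr pair_mixed_tail ?pair_tail_sum //.
    by rewrite !mulVf ?subrr // e0 //; lia.
  by lia.
rewrite lwedges_tail_sums.
have -> : [seq mixed_tail d k | k <- iota 1 m.-1] =
    [seq mixed_tail q k *: dlog_ratio k + (mixed_tail q k / z) *: tail_sum d 0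
    | k <- iota 1 m.-1].
  apply/eq_in_map => k; rewrite mem_iota => hk.
  rewrite /dlog_ratio scalerBr !scalerA divff ?scale1r ?subrK // e0 //; lia.
rewrite lwedge_mod -/p !linearZ /= lcontract_lwedge lcontract_lwedges; last exact: pair_dlog.
rewrite pair_tail_sum // lcontract_lwedge v1b scale0r sub0r lcontract_ext1.
rewrite !linear0.
rewrite lwedges0 scaler0 linear0 subr0 !linearZ /= lcontract_lwedges; last exact: pair_dlog.
rewrite lcontract_lwedge v2b lcontract_ext1 linear0 subr0 lwedgesZ.
rewrite !scalerA; congr (_ *: _); rewrite size_map size_iota -/z.
(* The sign (-1)^m comes from the change of coframe, and (-1)^(m-1) from moving [v2] past the
   logarithmic forms. Their product is -1. *)
have -> : (-1) ^+ m = - (-1) ^+ m.-1 :> K.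
  by case: (m) hj => [|k _]; [rewrite andbF | rewrite exprS mulN1r].
by rewrite -[RHS](signrMK m.-1) /GRing.scale /=; field.
Qed.
End AffineCoordinates.

(* Contracting the pair x_(2i) /\ x_(2i+1) with V_i gives the differential of the
   product of the two coordinates; [w] carries the pair that no V_i touches. *)
Lemma foldr_lcontract_lwedges (x : nat -> 'rV[K]_n) (V : nat -> 'rV[K]_n)
    (a : nat -> K) w N l :
  (forall i k, (l < i <= l + N)%N -> k != (2 * i)%N -> k != (2 * i).+1 ->
     pair (V i) (x k) = 0) ->
  (forall i, (l < i <= l + N)%N -> pair (V i) (x (2 * i)%N) = a (2 * i)%N) ->
  (forall i, (l < i <= l + N)%N -> pair (V i) (x (2 * i).+1) = - a (2 * i).+1) ->
  (forall i, (l < i <= l + N)%N -> lcontract (V i) w = 0) ->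
  foldr (@lcontract K n) (lwedges [seq x k | k <- iota 2 (2 * (l + N))] w)
    [seq V i | i <- iota l.+1 N] =
  lwedges [seq x k | k <- iota 2 (2 * l)]
    (lwedges [seq a (2 * i)%N *: x (2 * i).+1 + a (2 * i).+1 *: x (2 * i)%N
             | i <- iota l.+1 N] w).
Proof.
elim: N l => [|N IHN] l Vx Va Vb Vw; first by rewrite addn0.
(* [V l.+1] is contracted last, so the induction hypothesis at [l.+1] first deals with all later
   fields. *)
rewrite [foldr _ _ _]/= addnS -addSn IHN; first last.
- by move=> i hi; apply: Vw; lia.
- by move=> i hi; apply: Vb; lia.
- by move=> i hi; apply: Va; lia.
- by move=> i k hi; apply: Vx; lia.
have -> : iota 2 (2 * l.+1) = iota 2 (2 * l) ++ [:: 2 * l.+1; (2 * l.+1).+1]%N.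
  have {1}-> : (2 * l.+1 = 2 * l + 2)%N by lia.
  rewrite iotaD /=; congr (_ ++ [:: _; _]); lia.
rewrite map_cat lwedges_cat lcontract_lwedges => [|c /mapP[k]]; last first.
  by rewrite mem_iota => hk ->; apply: Vx; lia.
(* [V l.+1] passes [2 * l] factors that it annihilates, hence no sign. *)
rewrite size_map size_iota -signr_odd oddM scale1r; congr lwedges => /=.
set y := lwedges _ w.
have y0 : lcontract (V l.+1) y = 0.
  rewrite lcontract_lwedges ?Vw //; first last.
  - move=> c /mapP[k]; rewrite mem_iota => hk ->.
    by rewrite pairDr !pairZr !Vx ?mulr0 ?addr0 //; lia.
  - by lia.
  by rewrite lwedges0 scaler0.
rewrite !lcontract_lwedge y0 linear0 subr0 Va ?Vb; try lia.
by rewrite linearZ /= scaleNr opprK lwedgeDl !lwedgeZl.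
Qed.
End IteratedWedge.

(** * Differentials of functions through directional derivatives *)

Section Gradient.
Variables (K : numFieldType) (n : nat).
Implicit Types (f g : 'rV[K]_n -> K) (c d z v : 'rV[K]_n).

(** The row [c] holds the coefficients of df at [z]. Directional derivatives suffice because [dform]
    is built from them. *)
Definition has_grad f z c := forall v, is_derive z v f (pair v c).

Lemma grad_coord (i : 'I_n) z : has_grad (fun y => y 0 i) z (delta_mx 0 i).
Proof.
move=> v.
(* Packaged as a linear map, the coordinate function is its own differential. *)
have @f : {linear 'rV[K]_n -> K}.
  by exists (fun N : 'rV[K]_n => N 0 i); do 2![eexists]; do ?[constructor];
     rewrite ?mxE// => ? *; rewrite ?mxE//; move=> ?; rewrite !mxE.
have fc : continuous f by exact: coord_continuous.
apply: DeriveDef; first exact/diff_derivable/differentiable_coord.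
rewrite deriveE; last exact: differentiable_coord.
rewrite (@diff_lin _ _ _ f z fc) /pair (bigD1 i) //= mxE !eqxx mulr1.
by rewrite big1 ?addr0 // => k /negPf ki; rewrite mxE ki andbF mulr0.
Qed.

Lemma gradM f g z c d : has_grad f z c -> has_grad g z d ->
  has_grad (fun y => f y * g y) z (f z *: d + g z *: c).
Proof. by move=> fc gd v; rewrite pairDr !pairZr; apply: is_deriveM. Qed.

Lemma gradN f z c : has_grad f z c -> has_grad (fun y => - f y) z (- c).
Proof. by move=> fc v; rewrite pairNr; apply: is_deriveN. Qed.

Lemma grad_sum a b (h : nat -> 'rV[K]_n -> K) z (d : nat -> 'rV[K]_n) :
  (forall i, (a <= i < b)%N -> has_grad (h i) z (d i)) ->
  has_grad (fun y => \sum_(a <= i < b) h i y) z (\sum_(a <= i < b) d i).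
Proof.
move=> hd v; elim: b hd => [|b IHb] hd; last case: (leqP a b) => ab.
- rewrite big_geq // pair0r; under eq_fun do rewrite big_geq //.
  exact: is_derive_cst.
- rewrite big_nat_recr //= pairDr; under eq_fun do rewrite big_nat_recr //=.
  apply: is_deriveD; last by apply: hd; rewrite ab ltnSn.
  by apply: IHb => i /andP[ai ib]; apply: hd; rewrite ai ltnW.
- rewrite big_geq // pair0r; under eq_fun do rewrite big_geq //.
  exact: is_derive_cst.
Qed.
Lemma pair_delta c (i : 'I_n) : pair (delta_mx 0 i) c = c 0 i.
Proof.
rewrite /pair (bigD1 i) //= mxE !eqxx mul1r.
by rewrite big1 ?addr0 // => k /negPf ki; rewrite mxE ki andbF mul0r.
Qed.

Lemma dform_grad f z c : has_grad f z c -> dform f z = ext_linear c.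
Proof.
move=> fc; rewrite /dform; congr ext_linear; apply/rowP => i; rewrite mxE.
by have /@derive_val -> := fc (delta_mx 0 i); exact: pair_delta.
Qed.

Lemma ext_scale_linear a c : ext_scale a (ext_linear c) = ext_linear (a *: c).
Proof.
apply/ffunP => S; rewrite !ffunE mulr_sumr.
by apply: eq_bigr => i _; rewrite mxE mulrA.
Qed.

Lemma dlog_div f g z c d : has_grad f z c -> has_grad g z d ->
  f z != 0 -> g z != 0 ->
  dlog (fun y => f y / g y) z = ext_linear ((f z)^-1 *: c - (g z)^-1 *: d).
Proof.
move=> fc gd f0 g0.
have gV : has_grad (fun y => (g y)^-1) z (- (g z) ^- 2 *: d).
  move=> v; have [dg gE] := gd v; apply: DeriveDef; first exact: derivableV.
  by rewrite deriveV // gE pairZr.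
rewrite /dlog (dform_grad (gradM fc gV)) ext_scale_linear; congr ext_linear.
by rewrite scalerDr !scalerA addrC -scaleNr; congr (_ *: _ + _ *: _); field; rewrite ?f0 ?g0.
Qed.
End Gradient.

(** * The quadric in its affine chart, weights of the torus fields, and the final contraction *)

Section Quadric.
Variables (K : numFieldType) (m : nat).
Implicit Types (z v : 'rV[K]_(2 * m)).
Local Notation dz := (ddz K m).

Definition quad z i : K := zc (2 * i) z * zc (2 * i).+1 z.
Definition dquad z i : 'rV[K]_(2 * m) :=
  zc (2 * i) z *: dz (2 * i).+1 + zc (2 * i).+1 z *: dz (2 * i).

Lemma hc_unchart z k : hc (unchart z) k = zc k z.
Proof. by rewrite /zc unchart0 divr1. Qed.

Lemma zc1 z : zc 1 z = tail_sum m (quad z) 0.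
Proof.
rewrite -hc_unchart unchart1; congr (- _); apply: eq_big_nat => i _.
by rewrite !hc_unchart.
Qed.

Lemma zcE z k (lt_k : (k < 2 * m)%N) : zc k.+2 z = z 0 (Ordinal lt_k).
Proof.
have lt_k2 : (k.+2 < (2 * m).+2)%N by rewrite !ltnS.
rewrite -hc_unchart (hcE _ lt_k2) mxE /= insubT.
by congr (z 0 _); apply: val_inj.
Qed.

Lemma ddz_delta k (lt_k : (k < 2 * m)%N) : dz k.+2 = delta_mx 0 (Ordinal lt_k).
Proof. by apply/rowP => i; rewrite !mxE !eqSS -val_eqE. Qed.

Lemma grad_zc z k : (1 < k < (2 * m).+2)%N -> has_grad (zc k) z (dz k).
Proof.
case: k => [|[|k]] // /andP[_ lt_k]; rewrite !ltnS in lt_k.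
rewrite (ddz_delta lt_k) (_ : zc _ = fun y => y 0 (Ordinal lt_k)).
  exact: grad_coord.
by apply/funext => y; rewrite zcE.
Qed.

Lemma pair_ddz k l : (1 < k < (2 * m).+2)%N -> pair (dz k) (dz l) = (k == l)%:R.
Proof.
case: k => [|[|k]] // /andP[_ lt_k]; rewrite !ltnS in lt_k.
by rewrite (ddz_delta lt_k) pair_delta mxE.
Qed.

Lemma Bsum_tail z k : (k <= m)%N -> Bsum k z = tail_sum m (quad z) k.
Proof.
move=> km; rewrite /Bsum zc1 /tail_sum (big_cat_nat _ (n := k.+1)) //=.
by rewrite opprD addrAC addNr add0r.
Qed.

Lemma grad_quad z i : (0 < i <= m)%N -> has_grad (quad^~ i) z (dquad z i).
Proof. by move=> hi; apply: gradM; apply: grad_zc; lia. Qed.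

Lemma grad_tail z k : has_grad (fun y => tail_sum m (quad y) k) z
  (tail_sum m (dquad z) k).
Proof.
apply/gradN/(grad_sum (h := fun i y => quad y i)) => i hi.
by apply: grad_quad; lia.
Qed.

Lemma pair_torus_small z i k : (0 < i < m)%N ->
  pair (torus_field i z) (dz k) =
  zc (2 * i) z * (2 * i == k)%:R - zc (2 * i).+1 z * ((2 * i).+1 == k)%:R.
Proof.
move=> hi; rewrite /torus_field ifT; last by lia.
rewrite pairC pairDr pairNr !pairZr ![pair (dz k) _]pairC !pair_ddz //; lia.
Qed.

Lemma pair_torus_large z i k : (m <= i)%N -> (0 < m)%N ->
  let l := if i == m then (2 * m)%N else (2 * m).+1 in
  pair (torus_field i z) (dz k) =
  zc l z * (l == k)%:R +
  \sum_(1 <= l < m) zc (2 * l).+1 z * ((2 * l).+1 == k)%:R.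
Proof.
move=> hi m0 l; rewrite /torus_field ifF -/l; last by lia.
rewrite pairC pairDr pairZr pair_sumr [pair (dz k) _]pairC pair_ddz; last first.
  by rewrite /l; case: ifP; lia.
congr (_ + _); apply: eq_big_nat => p hp.
by rewrite pairZr pairC pair_ddz //; lia.
Qed.

Lemma pair_torus_even z i k : (m <= i)%N -> (0 < k <= m)%N ->
  pair (torus_field i z) (dz (2 * k)) =
  ((i == m) && (k == m))%:R * zc (2 * k) z.
Proof.
move=> hi hk; rewrite pair_torus_large //; last by lia.
rewrite big_nat big1 => [|p hp]; last first.
  by rewrite (_ : (_ == _) = false) ?mulr0 //; lia.
rewrite addr0; case: (eqVneq i m) => _ /=.
  by rewrite eqn_mul2l /= eq_sym; case: eqVneq => [->|]; rewrite ?mulr0 ?mul0r ?mulr1 ?mul1r.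
by rewrite (_ : (_ == _) = false) ?mulr0 ?mul0r //; lia.
Qed.

Lemma pair_torus_odd z i k : (m <= i)%N -> (0 < k <= m)%N ->
  pair (torus_field i z) (dz (2 * k).+1) =
  ((i != m) || (k != m))%:R * zc (2 * k).+1 z.
Proof.
move=> hi hk; rewrite pair_torus_large //; last by lia.
case: (eqVneq k m) => [->|km].
  rewrite big_nat big1 => [|p hp]; last first.
    by rewrite (_ : (_ == _) = false) ?mulr0 //; lia.
  rewrite addr0 orbF; case: (eqVneq i m) => _ /=.
    by rewrite (_ : (_ == _) = false) ?mulr0 ?mul0r //; lia.
  by rewrite eqxx mulr1 mul1r.
rewrite orbT mul1r (_ : ((if _ then _ else _) == _) = false) ?mulr0 ?add0r;
  last by case: ifP; lia.
rewrite (bigD1_seq k) ?mem_index_iota ?iota_uniq //=; last by lia.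
rewrite eqxx mulr1 big1 ?addr0 // => p /negPf pk.
by rewrite (_ : (_ == _) = false) ?mulr0 //; lia.
Qed.

(** Of the two coordinates in each pair, exactly one has weight one and the other weight zero, so
    their product has weight one by the Leibniz rule. *)
Lemma pair_torus_dquad z i k : (m <= i)%N -> (0 < k <= m)%N ->
  pair (torus_field i z) (dquad z k) = quad z k.
Proof.
move=> hi hk; rewrite pairDr !pairZr pair_torus_even // pair_torus_odd // /quad.
by case: (i == m); case: (k == m) => /=; ring.
Qed.

(** The minus sign arises from the factor z_(2m) z_(2m+1), which is the negative of [mixed_tail] at
    [m.-1]. *)
Lemma Omega_denE j z : (0 < j < m)%N ->
  Omega_den j z = - (tail_sum m (quad z) 0 *
    \prod_(k <- iota 1 m.-1) mixed_tail m j (quad z) k).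
Proof.
move=> hj; rewrite /Omega_den zc1 -(mulrA _ (zc (2 * m) z)) -/(quad z m).
rewrite -!(mulrA (tail_sum _ _ _)) -mulrN; congr (_ * _).
(* The factors z_2, ..., z_(2j-1) are grouped into consecutive pairs. *)
have -> : \prod_(2 <= k < 2 * j) zc k z = \prod_(1 <= k < j) quad z k.
  have : (0 < j)%N by lia.
  elim: (j) => [//|[|p] IHp _]; first by rewrite (big_geq (leqnn 2)) (big_geq (leqnn 1)).
  rewrite [RHS]big_nat_recr //= -IHp // (_ : 2 * p.+2 = (2 * p.+1).+2)%N; last by lia.
  rewrite big_nat_recr; last by lia.
  by rewrite big_nat_recr /= ?mulrA //; lia.
have -> : iota 1 m.-1 = index_iota 1 m by rewrite /index_iota subn1.
rewrite [in RHS](big_cat_nat _ (n := j)) /=; try lia.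
rewrite -mulrN -mulrA; congr (_ * _).
  by apply: eq_big_nat => k /andP[_ kj]; rewrite /mixed_tail kj.
rewrite (_ : index_iota j m = index_iota j m.-1.+1); last by congr index_iota; lia.
rewrite big_nat_recr /=; last by lia.
rewrite -mulrN; congr (_ * _).
  apply: eq_big_nat => k hk; rewrite Bsum_tail; last by lia.
  by rewrite /mixed_tail ifF //; lia.
rewrite /mixed_tail ifF; last by lia.
by rewrite /tail_sum opprK prednK ?big_nat1 //; lia.
Qed.

(** Wedge products are pointwise, so each factor has to be known only at [z]; this reduces the
    identity to exterior algebra at one point. *)
Lemma wedge_seq_lwedges (T : eqType) (r : seq T) (F : T -> form K (2 * m))
    (c : T -> 'rV[K]_(2 * m)) z :
  {in r, forall k, F k z = ext_linear (c k)} ->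
  wedge_seq [seq F k | k <- r] z = lwedges [seq c k | k <- r] (ext1 K (2 * m)).
Proof.
elim: r => //= k r IHr hF; rewrite /form_wedge hF ?mem_head // IHr // => l rl.
by apply: hF; rewrite inE rl orbT.
Qed.

Lemma foldr_interior_product (w : form K (2 * m)) (Vs : seq (vfield K (2 * m))) z :
  foldr (@interior_product K (2 * m)) w Vs z =
  foldr (@lcontract K (2 * m)) (w z) [seq V z | V <- Vs].
Proof. by elim: Vs => //= V Vs IHVs; rewrite /interior_product IHVs. Qed.

Lemma foldr_lcontractZ a (vs : seq 'rV[K]_(2 * m)) w :
  foldr (@lcontract K (2 * m)) (a *: w) vs = a *: foldr (@lcontract K (2 * m)) w vs.
Proof. by elim: vs => //= v vs ->; rewrite linearZ. Qed.

(* The index m of the last function g_m plays the role of k = m - 1, because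
   g_m = - B_(m-1) / z_1. *)
Lemma dlog_gfun j k z : (0 < j < m)%N -> (0 < k < m)%N ->
  tail_sum m (quad z) 0 != 0 -> mixed_tail m j (quad z) k != 0 ->
  dlog (fun y => gfun j (if k == m.-1 then m else k) (unchart y)) z =
  ext_linear (dlog_ratio m j (dquad z) (quad z) k).
Proof.
move=> hj hk z0 ek0.
have hc01 y : hc (unchart y) 0 * hc (unchart y) 1 = tail_sum m (quad y) 0.
  by rewrite unchart0 mul1r hc_unchart zc1.
case: (ltnP k j) => kj.
  case: (eqVneq k m.-1) => [|_]; first by lia.
  have -> : (fun y => gfun j k (unchart y)) =
      fun y => quad y k / tail_sum m (quad y) 0.
    apply/funext => y; rewrite /gfun ifF; last by lia.
    by rewrite !hc01 !hc_unchart.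
  rewrite /mixed_tail kj in ek0.
  rewrite (dlog_div (@grad_quad z k _) (@grad_tail z 0)) //; last by lia.
  by rewrite /dlog_ratio /mixed_tail kj.
case: (eqVneq k m.-1) => [km|km].
  have mixedN (V : zmodType) (f : nat -> V) : mixed_tail m j f k = - f m.
    rewrite /mixed_tail ifF ?/tail_sum ?km ?prednK ?big_nat1 //; lia.
  have -> : (fun y => gfun j m (unchart y)) =
      fun y => quad y m / tail_sum m (quad y) 0.
    apply/funext => y; rewrite /gfun ifF; last by lia.
    by rewrite !hc01 !hc_unchart.
  rewrite mixedN oppr_eq0 in ek0.
  rewrite (dlog_div (@grad_quad z m _) (@grad_tail z 0)) //; last by lia.
  (* A logarithmic differential does not see the sign of its function. *)
  rewrite /dlog_ratio !mixedN (invrN (quad z m)) (scaleNr (quad z m)^-1).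
  by rewrite (scalerN _ (dquad z m)) opprK.
have mixedE (V : zmodType) (f : nat -> V) : mixed_tail m j f k = tail_sum m f k.
  by rewrite /mixed_tail ifF //; lia.
have -> : (fun y => gfun j k (unchart y)) =
    fun y => tail_sum m (quad y) k / tail_sum m (quad y) 0.
  apply/funext => y; rewrite /gfun ifT; last by lia.
  rewrite hc01 -(@Bsum_tail y k); last by lia.
  (* The summand [i = 0] is x_0 x_1, which equals z_1 on the chart and is the leading term of
     B_k. *)
  rewrite big_ltn // muln0 hc01 -zc1; congr (_ / _); congr (_ + _).
  by apply: eq_big_nat => i _; rewrite !hc_unchart.
rewrite mixedE in ek0.
by rewrite (dlog_div (@grad_tail z k) (@grad_tail z 0)) // /dlog_ratio !mixedE.
Qed.

Lemma Omega_lwedges z :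
  @Omega K m z = lwedges [seq dz k | k <- iota 2 (2 * m)] (ext1 K (2 * m)).
Proof.
apply: wedge_seq_lwedges => k; rewrite mem_iota => hk.
by apply/dform_grad/grad_zc; lia.
Qed.

Lemma contraction_Omega_X j z : (0 < j < m)%N -> Omega_den j z != 0 ->
  interior_product (@torus_field K m m.+1)
    (interior_product (@torus_field K m m)
      (foldr (@interior_product K (2 * m)) (@Omega_X K m j)
        [seq @torus_field K m i | i <- iota 1 (m - 1)])) z
  = wedge_seq [seq dlog (fun y => gfun j k (unchart y))
      | k <- rcons (iota 1 (m - 2)) m] z.
Proof.
move=> hj den0.
have b0 : zc (2 * m).+1 z != 0.
  by apply: contraNneq den0 => b0; rewrite /Omega_den b0 mulr0.
have denE := Omega_denE z hj.
move: (den0); rewrite denE oppr_eq0 mulf_eq0 negb_or => /andP[z0].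
rewrite prodf_seq_neq0 => /allP e0.
have e0' k : (0 < k < m)%N -> mixed_tail m j (quad z) k != 0.
  by move=> hk; apply: e0; rewrite mem_iota; lia.
have -> : rcons (iota 1 (m - 2)) m =
    [seq if k == m.-1 then m else k | k <- iota 1 m.-1].
  have -> : m.-1 = (m - 2 + 1)%N by lia.
  rewrite iotaD map_cat -cats1 /=; congr (_ ++ _).
    rewrite -[LHS]map_id; apply/eq_in_map => k; rewrite mem_iota => hk.
    by rewrite ifF //; lia.
  by rewrite ifT //; lia.
rewrite -map_comp (@wedge_seq_lwedges _ _ _ (dlog_ratio m j (dquad z) (quad z))); last first.
  by move=> k; rewrite mem_iota => hk; apply: dlog_gfun => //; rewrite ?e0' //; lia.
change (lcontract (torus_field m.+1 z) (lcontract (torus_field m z)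
  (foldr (@interior_product K (2 * m)) (@Omega_X K m j)
    [seq @torus_field K m i | i <- iota 1 (m - 1)] z)) =
  lwedges [seq dlog_ratio m j (dquad z) (quad z) k | k <- iota 1 m.-1]
    (ext1 K (2 * m))).
rewrite foldr_interior_product -map_comp.
(* The last pair dz_(2m) dz_(2m+1) is split off as the tail; the cast to [K^o] gives access to the
   linearity of contraction. *)
have -> : Omega_X j z = (Omega_den j z)^-1 *:
    (lwedges [seq dz k | k <- iota 2 (2 * (0 + m.-1))]
      (lwedge (dz (2 * m)) (lwedge (dz (2 * m).+1) (ext1 K (2 * m))))
      : {ffun {set 'I_(2 * m)} -> K^o}).
  rewrite /Omega_X Omega_lwedges.
  have -> : iota 2 (2 * m) = iota 2 (2 * (0 + m.-1) + 2) by congr iota; lia.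
  rewrite iotaD map_cat lwedges_cat /=.
  have -> : (2 + 2 * (0 + m.-1) = 2 * m)%N by lia.
  by apply/ffunP => S; rewrite !ffunE.
rewrite foldr_lcontractZ subn1.
(* Taken with [l = 0]: no pair remains in front, and the forms produced are the [dquad z i]. *)
rewrite (@foldr_lcontract_lwedges _ _ _ (fun i => torus_field i z) (fun k => zc k z)).
- rewrite !linearZ /= (@lcontract2_lwedges _ _ m j (dquad z) (quad z) hj
    (dz (2 * m)) (dz (2 * m).+1) _ _ (zc (2 * m) z) (zc (2 * m).+1 z)) //.
  (* The scalar produced by the two contractions is exactly [Omega_den j z], sign included. *)
  + by rewrite scalerA -denE mulVf // scale1r.
  + by move=> i hi; apply: pair_torus_dquad.
  + by move=> i hi; apply: pair_torus_dquad.
  + by rewrite pair_torus_odd ?eqxx ?mul0r //; lia.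
  + rewrite pair_torus_odd; [|lia..].
    by rewrite (_ : _ || _ = true) ?mul1r //; lia.
- move=> i k hi h1 h2; rewrite pair_torus_small; last by lia.
  by rewrite ![_ == k]eq_sym (negPf h1) (negPf h2) !mulr0 subr0.
- move=> i hi; rewrite pair_torus_small; last by lia.
  by rewrite eqxx mulr1 (_ : (_ == _) = false) ?mulr0 ?subr0 //; lia.
- move=> i hi; rewrite pair_torus_small; last by lia.
  by rewrite eqxx mulr1 (_ : (_ == _) = false) ?mulr0 ?sub0r //; lia.
- move=> i hi.
  (* For [i < m] the field has no component along the last pair, so it annihilates the tail. *)
  have pair0 k : (2 * m <= k)%N -> pair (torus_field i z) (dz k) = 0.
    move=> hk; rewrite pair_torus_small; last by lia.
    rewrite (_ : (2 * i == k)%N = false); last by lia.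
    by rewrite (_ : ((2 * i).+1 == k)%N = false) ?mulr0 ?subr0 //; lia.
  rewrite lcontract_lwedge pair0 // scale0r sub0r.
  rewrite lcontract_lwedge pair0 // scale0r sub0r lcontract_ext1.
  by rewrite !linear0.
Qed.
End Quadric.

Theorem proposition3p8 (R : realType) (m j : nat) (hm : (2 <= m)%N)
    (hj : (1 <= j <= m - 1)%N)
    (x : 'rV[R[i]]_((2 * m).+2)) (hX : on_quadric x) (hx0 : hc x 0 != 0)
    (hreg : Omega_den j (chart x) != 0) :
  interior_product (@torus_field R[i] m m.+1)
    (interior_product (@torus_field R[i] m m)
      (foldr (@interior_product R[i] (2 * m)) (@Omega_X R[i] m j)
        [seq @torus_field R[i] m i | i <- iota 1 (m - 1)])) (chart x)
  = wedge_seq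
      [seq dlog (fun z : 'rV[R[i]]_(2 * m) => gfun j k (unchart z))
      | k <- rcons (iota 1 (m - 2)) m] (chart x).
Proof.
by apply: contraction_Omega_X; last exact: hreg; lia.
Qed.
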